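(* Let $n\ge1$. The map $(\mathrm{vlk}_{ij})_{1\le i\neq j\le n}$ with values in $\mathbb{Z}^{n(n-1)}$ w-classifies $\mathrm{F}$; that is, it is invariant under welded Reidemeister moves and under $\mathrm{F}$, and the induced map $\mathrm{wSL}_n^{\mathrm{F}}\to\mathbb{Z}^{n(n-1)}$ is an isomorphism of monoids.
   Context: A Gauss diagram on $n$ strands is a finite set of signed arrows (tail, head, sign $\pm1$), all endpoints being distinct points of $n$ ordered oriented intervals (strands), up to orientation-preserving homeomorphisms of the intervals; Gauss diagrams form a monoid under stacking (concatenation of corresponding strands). Endpoints are adjacent if they lie on the same strand with no other endpoint between them. Moves are used in both directions; portions of strands below are disjoint, contain only the mentioned endpoints, and may lie on any strands with any orientation. Welded Reidemeister moves: (R1) insert or delete an arrow of any sign with adjacent endpoints; (R2) insert or delete two arrows with opposite signs whose tails are adjacent on one portion and whose heads are adjacent on another; (R3) given portions $s_1,s_2,s_3$ containing exactly the endpoints of arrows $s_1\to s_2$, $s_2\to s_3$, $s_1\to s_3$ with signs $\varepsilon_{12},\varepsilon_{23},\varepsilon_{13}$, exchange the two endpoints on each portion, provided $\varepsilon_{12}\eta_1\eta_2=\varepsilon_{23}\eta_2\eta_3=-\varepsilon_{13}\eta_1\eta_3$, where $\eta_k=+1$ if along the orientation the endpoint on $s_k$ of the arrow joining $s_k$ and $s_{k-1}$ precedes that of the arrow joining $s_k$ and $s_{k+1}$ (indices mod 3), and $-1$ otherwise; (OC) exchange two adjacent tails. The monoid $\mathrm{wSL}_n$ of welded string links is the quotient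 of Gauss diagrams on $n$ strands by these moves (equivalently, virtual string link diagrams up to welded Reidemeister moves), and $\mathrm{wSL}_n^\mu$ is its quotient by a move $\mu$. $\mathrm{F}$: exchange an adjacent tail and head of two distinct arrows. For $i\neq j$, $\mathrm{vlk}_{ij}$ is the sum of the signs of all arrows with tail on strand $i$ and head on strand $j$. *)

(* Defs.v *)
From Stdlib Require Import Relations.
From HB Require Import structures.
From mathcomp Require Import all_boot all_order all_algebra zify boolp.

Set Implicit Arguments.
Unset Strict Implicit.
Unset Printing Implicit Defensive.

Import GRing.Theory.
Local Open Scope ring_scope.

(* An arrow is an identifier together with its sign ([true] is +1); an endpoint
   of [a] is [(a, false)] (its tail) or [(a, true)] (its head). *)
Definition arrow : Type := (nat * bool)%type.
HB.instance Definition _ := Countable.on arrow.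
Definition endpoint : Type := (arrow * bool)%type.
HB.instance Definition _ := Countable.on endpoint.

Definition arrow_tail (a : arrow) : endpoint := (a, false).
Definition arrow_head (a : arrow) : endpoint := (a, true).

Definition sgn (s : bool) : int := if s then 1 else -1.

Notation strands n := {ffun 'I_n -> seq endpoint}.

Definition endpoints n (w : strands n) : seq endpoint := flatten (codom w).

Definition wf_strands n (w : strands n) : bool :=
  uniq (endpoints w)
  && all (fun e : endpoint => (e.1, ~~ e.2) \in endpoints w) (endpoints w).

(* A Gauss diagram on n strands with named arrows: each strand is the word of
   its endpoints, read along the orientation, and each arrow that occurs has
   exactly one tail and one head.  Up to homeomorphisms of the intervals, Gauss
   diagrams are these objects up to renaming of arrows, i.e. up to [gauss_iso]. *)
Record gauss n := Gauss { strand :> strands n; gaussP : wf_strands strand }.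
HB.instance Definition _ n := [isSub for @strand n].
HB.instance Definition _ n := [Choice of gauss n by <:].

Definition arrows n (D : gauss n) : seq arrow :=
  undup [seq e.1 | e <- endpoints D].

Definition map_strands (f : endpoint -> endpoint) n (w : strands n) :
  strands n := [ffun i => map f (w i)].

Definition relabel (f : arrow -> arrow) (e : endpoint) : endpoint :=
  (f e.1, e.2).

Definition gauss_iso n (D D' : gauss n) : Prop :=
  exists f : arrow -> arrow,
    [/\ {in arrows D &, injective f},
        {in arrows D, forall a, (f a).2 = a.2}
      & strand D' = map_strands (relabel f) D].

Definition precedes n (D : gauss n) (x y : endpoint) : bool :=
  [exists i, infix [:: x; y] (D i)].

Definition adjacent n (D : gauss n) (x y : endpoint) : bool :=
  precedes D x y || precedes D y x.

(* [x] and [y] are adjacent, and [eta] is the sign recording whether [x] comes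
   before [y]. *)
Definition portion n (D : gauss n) (eta : bool) (x y : endpoint) : bool :=
  if eta then precedes D x y else precedes D y x.

Definition delete n (A : seq arrow) (w : strands n) : strands n :=
  [ffun i => [seq e <- w i | e.1 \notin A]].

(* Endpoints occur only once, so swapping the letters [x] and [y] in the words
   exchanges the positions of these two endpoints. *)
Definition exchange n (x y : endpoint) (w : strands n) : strands n :=
  map_strands [eta id with x |-> y, y |-> x] w.

(* R1 and R2 are oriented as deletions; insertions come from the symmetric
   closure in [wslF_eq]. *)
Definition R1_move n (D D' : gauss n) : Prop :=
  exists a, adjacent D (arrow_tail a) (arrow_head a) /\ strand D' = delete [:: a] D.

Definition R2_move n (D D' : gauss n) : Prop :=
  exists a b, [/\ a.2 = ~~ b.2,
                  adjacent D (arrow_tail a) (arrow_tail b),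
                  adjacent D (arrow_head a) (arrow_head b)
                & strand D' = delete [:: a; b] D].

(* The arrow [aij] goes from portion i to portion j.  Distinctness of the three
   arrows makes the three portions disjoint. *)
Definition R3_move n (D D' : gauss n) : Prop :=
  exists a12 a23 a13 eta1 eta2 eta3,
    [/\ uniq [:: a12; a23; a13],
        [/\ portion D eta1 (arrow_tail a13) (arrow_tail a12),
            portion D eta2 (arrow_head a12) (arrow_tail a23)
          & portion D eta3 (arrow_head a23) (arrow_head a13)],
        sgn a12.2 * sgn eta1 * sgn eta2 = sgn a23.2 * sgn eta2 * sgn eta3,
        sgn a23.2 * sgn eta2 * sgn eta3 = - (sgn a13.2 * sgn eta1 * sgn eta3)
      & strand D' = exchange (arrow_tail a13) (arrow_tail a12)
                   (exchange (arrow_head a12) (arrow_tail a23)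
                   (exchange (arrow_head a23) (arrow_head a13) D))].

Definition OC_move n (D D' : gauss n) : Prop :=
  exists a b, adjacent D (arrow_tail a) (arrow_tail b)
              /\ strand D' = exchange (arrow_tail a) (arrow_tail b) D.

Definition welded_move n (D D' : gauss n) : Prop :=
  [\/ R1_move D D', R2_move D D', R3_move D D' | OC_move D D'].

Definition F_move n (D D' : gauss n) : Prop :=
  exists a b, [/\ a != b, adjacent D (arrow_tail a) (arrow_head b)
                & strand D' = exchange (arrow_tail a) (arrow_head b) D].

(* The quotient of wSL_n by F is the quotient of Gauss diagrams by the welded
   moves and F together. *)
Definition wslF_step n (D D' : gauss n) : Prop :=
  [\/ gauss_iso D D', welded_move D D' | F_move D D'].

Definition wslF_eq n : gauss n -> gauss n -> Prop :=
  clos_refl_sym_trans (gauss n) (@wslF_step n).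

(* Stacking makes the arrow names of the two diagrams disjoint. *)
Definition lft (a : arrow) : arrow := (a.1.*2, a.2).
Definition rgt (a : arrow) : arrow := (a.1.*2.+1, a.2).

Definition stack_strands n (v w : strands n) : strands n :=
  [ffun i => map (relabel lft) (v i) ++ map (relabel rgt) (w i)].

Lemma endpointsP n (w : strands n) e :
  reflect (exists i, e \in w i) (e \in endpoints w).
Proof.
apply: (iffP flattenP) => [[s /codomP [i ->]]|[i]]; first by exists i.
by exists (w i) => //; apply: codom_f.
Qed.

Lemma relabel_inj f : injective f -> injective (relabel f).
Proof. by move=> fI [a b] [c d] [/fI -> ->]. Qed.

Lemma lft_inj : injective lft.
Proof. by move=> [a s] [b t] [/double_inj -> ->]. Qed.

Lemma rgt_inj : injective rgt.
Proof. by move=> [a s] [b t] [/double_inj -> ->]. Qed.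

Lemma perm_flatten_cat (I T : eqType) (r : seq I) (f g : I -> seq T) :
  perm_eq (flatten [seq f i ++ g i | i <- r])
          (flatten [seq f i | i <- r] ++ flatten [seq g i | i <- r]).
Proof.
elim: r => //= i r IH; rewrite -!catA perm_cat2l.
by rewrite perm_sym perm_catCA perm_cat2l perm_sym.
Qed.

Lemma endpoints_stack n (v w : strands n) :
  perm_eq (endpoints (stack_strands v w))
          (map (relabel lft) (endpoints v) ++ map (relabel rgt) (endpoints w)).
Proof.
rewrite /endpoints !codomE !map_flatten -!map_comp.
rewrite (eq_map (ffunE _)).
exact: (perm_flatten_cat (I := 'I_n)).
Qed.

Lemma stack_wf n (D E : gauss n) : wf_strands (stack_strands D E).
Proof.
have /andP [uD /allP tD] := gaussP D; have /andP [uE /allP tE] := gaussP E.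
have pS := endpoints_stack D E.
apply/andP; split.
  rewrite (perm_uniq pS) cat_uniq !map_inj_uniq ?uD ?uE /=;
    [|exact: relabel_inj rgt_inj|exact: relabel_inj lft_inj].
  rewrite andbT; apply/hasPn => _ /mapP [[[a s] b] _ ->].
  by apply/mapP => -[[[c t] d] _ [H]]; lia.
apply/allP => e; rewrite !(perm_mem pS) !mem_cat.
case/orP => /mapP [x xD ->]; apply/orP; [left|right].
  by apply/mapP; exists (x.1, ~~ x.2) => //; apply: tD.
by apply/mapP; exists (x.1, ~~ x.2) => //; apply: tE.
Qed.

Definition stack n (D E : gauss n) : gauss n := Gauss (stack_wf D E).

Lemma empty_wf n : wf_strands ([ffun=> [::]] : strands n).
Proof.
have E : endpoints ([ffun=> [::]] : strands n) = [::]; last by rewrite /wf_strands E.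
by rewrite /endpoints codomE (eq_map (ffunE _)); elim: (enum _).
Qed.

Definition empty_gauss n : gauss n := Gauss (empty_wf n).

(* [plug g u v X] places a copy of [X], renamed by [g], between [u] and [v];
   [h] is a partial inverse of [g]. *)
Section Plug.
Variables (n : nat) (g : arrow -> arrow) (h : arrow -> option arrow).
Variables (u v : 'I_n -> seq endpoint).
Hypothesis gK : pcancel g h.
Hypothesis g_sgn : forall a, (g a).2 = a.2.
Hypothesis uN : forall i e, e \in u i -> h e.1 = None.
Hypothesis vN : forall i e, e \in v i -> h e.1 = None.

Definition plug (w : strands n) : strands n :=
  [ffun i => u i ++ map (relabel g) (w i) ++ v i].

Let g_inj : injective g := pcan_inj gK.

Lemma precedes_plug (X Z : gauss n) x y : strand Z = plug X ->
  precedes X x y -> precedes Z (relabel g x) (relabel g y).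
Proof.
move=> ZE /existsP [i /infixP [s1 [s2 E]]]; apply/existsP; exists i.
rewrite ZE ffunE E !map_cat /=; apply/infixP.
by exists (u i ++ map (relabel g) s1), (map (relabel g) s2 ++ v i); rewrite -!catA.
Qed.

Lemma adjacent_plug (X Z : gauss n) x y : strand Z = plug X ->
  adjacent X x y -> adjacent Z (relabel g x) (relabel g y).
Proof.
by move=> ZE /orP [] p; apply/orP; [left|right]; apply: (precedes_plug ZE).
Qed.

Lemma portion_plug (X Z : gauss n) s x y : strand Z = plug X ->
  portion X s x y -> portion Z s (relabel g x) (relabel g y).
Proof. by move=> ZE; case: s => p; apply: (precedes_plug ZE). Qed.

Lemma map_strands_plug f f' (w : strands n) :
  (forall i e, e \in w i -> f' (relabel g e) = relabel g (f e)) ->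
  (forall e, h e.1 = None -> f' e = e) ->
  plug (map_strands f w) = map_strands f' (plug w).
Proof.
move=> ff f0; apply/ffunP => i; rewrite !ffunE !map_cat; congr (_ ++ (_ ++ _)).
- by rewrite -[LHS]map_id; apply/eq_in_map => e /uN /f0.
- by rewrite -!map_comp; apply/eq_in_map => e /ff /= ->.
by rewrite -[LHS]map_id; apply/eq_in_map => e /vN /f0.
Qed.

Lemma exchange_plug x y (w : strands n) :
  plug (exchange x y w) = exchange (relabel g x) (relabel g y) (plug w).
Proof.
have gI := relabel_inj g_inj.
apply: map_strands_plug => [i e _ /=|e he /=].
  by rewrite !(inj_eq gI); case: eqP => // _; case: eqP.
have N z : (e == relabel g z) = false.
  by apply/negbTE/eqP => E; move: he; rewrite E /= gK.
by rewrite !N.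
Qed.

Lemma delete_plug A (w : strands n) :
  plug (delete A w) = delete (map g A) (plug w).
Proof.
have fN s : (forall e : endpoint, e \in s -> h e.1 = None) ->
    [seq e <- s | e.1 \notin map g A] = s.
  move=> sN; apply/all_filterP/allP => e /sN he.
  by apply/mapP => -[a _ E]; move: he; rewrite E gK.
apply/ffunP => i; rewrite !ffunE !filter_cat (fN (u i)) ?(fN (v i)); [|exact: vN|exact: uN].
congr (_ ++ (_ ++ _)); rewrite filter_map; congr map; apply: eq_filter => e /=.
by rewrite mem_map.
Qed.

Lemma iso_plug (X X' Z Z' : gauss n) :
  strand Z = plug X -> strand Z' = plug X' -> gauss_iso X X' -> gauss_iso Z Z'.
Proof.
move=> ZE ZE' [f [fI fS E]].
pose f' a := if h a is Some b then g (f b) else a.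
have arrE a b : a \in arrows Z -> h a = Some b -> a = g b /\ b \in arrows X.
  rewrite mem_undup => /mapP [e /endpointsP [i]] ea ->; move: ea.
  rewrite ZE ffunE !mem_cat => /or3P [/uN -> //||/vN -> //].
  case/mapP => c cX -> /=; rewrite gK => -[<-]; split=> //.
  by rewrite mem_undup; apply/mapP; exists c => //; apply/endpointsP; exists i.
exists f'; split.
- move=> a b aZ bZ; rewrite /f'.
  case ha: (h a) => [a'|]; case hb: (h b) => [b'|] // E'.
  + have [-> aX] := arrE _ _ aZ ha; have [-> bX] := arrE _ _ bZ hb.
    by congr g; apply: fI => //; apply: g_inj.
  + by move: hb; rewrite -E' gK.
  + by move: ha; rewrite E' gK.
- move=> a aZ; rewrite /f'; case ha: (h a) => [b|] //.
  by have [-> bX] := arrE _ _ aZ ha; rewrite !g_sgn fS.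
rewrite ZE' ZE E; apply: map_strands_plug.
  by move=> i e _; rewrite /relabel /f' /= gK.
by case=> a b /= ha; rewrite /relabel /f' /= ha.
Qed.

Lemma wslF_step_plug (X X' Z Z' : gauss n) :
  strand Z = plug X -> strand Z' = plug X' -> wslF_step X X' -> wslF_step Z Z'.
Proof.
move=> ZE ZE' [XX'|[]|].
- by apply: Or31; apply: iso_plug XX'.
- move=> [a [adj E]]; apply/Or32/Or41; exists (g a); split.
    exact: adjacent_plug ZE adj.
  by rewrite ZE' E delete_plug -ZE.
- move=> [a [b [s adj adj' E]]]; apply/Or32/Or42; exists (g a), (g b); split.
  + by rewrite !g_sgn.
  + exact: adjacent_plug ZE adj.
  + exact: adjacent_plug ZE adj'.
  by rewrite ZE' E delete_plug -ZE.
- move=> [a [b [c [e1 [e2 [e3 [abc [p1 p2 p3] s1 s2 E]]]]]]].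
  apply/Or32/Or43; exists (g a), (g b), (g c), e1, e2, e3; split.
  + by rewrite -(map_inj_uniq g_inj) in abc.
  + split; [exact: portion_plug ZE p1|exact: portion_plug ZE p2|].
    exact: portion_plug ZE p3.
  + by rewrite !g_sgn.
  + by rewrite !g_sgn.
  by rewrite ZE' E !exchange_plug -ZE.
- move=> [a [b [adj E]]]; apply/Or32/Or44; exists (g a), (g b); split.
    exact: adjacent_plug ZE adj.
  by rewrite ZE' E exchange_plug -ZE.
move=> [a [b [ab adj E]]]; apply/Or33; exists (g a), (g b); split.
- by rewrite (inj_eq g_inj).
- exact: adjacent_plug ZE adj.
by rewrite ZE' E exchange_plug -ZE.
Qed.

End Plug.

Lemma wslF_eq_stackl n (D D' E : gauss n) :
  wslF_eq D D' -> wslF_eq (stack D E) (stack D' E).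
Proof.
elim=> {D D'} [D D' st|D|D D' _|D D' D'' _ IH _]; last first.
- exact: rst_trans.
- exact: rst_sym.
- exact: rst_refl.
apply: rst_step.
pose h (a : arrow) : option arrow := if odd a.1 then None else Some (a.1./2, a.2).
have st_plug (X : gauss n) :
    strand (stack X E) =
    plug lft (fun=> [::]) (fun i => map (relabel rgt) (E i)) X.
  by apply/ffunP => i; rewrite !ffunE.
apply: (wslF_step_plug (h := h) _ _ _ _ (st_plug D) (st_plug D')) => //.
- by case=> a s; rewrite /h /= odd_double doubleK.
- by move=> i _ /mapP [e _ ->]; rewrite /h /= odd_double.
Qed.

Lemma wslF_eq_stackr n (D E E' : gauss n) :
  wslF_eq E E' -> wslF_eq (stack D E) (stack D E').
Proof.
elim=> {E E'} [E E' st|E|E E' _|E E' E'' _ IH _]; last first.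
- exact: rst_trans.
- exact: rst_sym.
- exact: rst_refl.
apply: rst_step.
pose h (a : arrow) : option arrow := if odd a.1 then Some (a.1./2, a.2) else None.
have st_plug (X : gauss n) :
    strand (stack D X) =
    plug rgt (fun i => map (relabel lft) (D i)) (fun=> [::]) X.
  by apply/ffunP => i; rewrite !ffunE cats0.
apply: (wslF_step_plug (h := h) _ _ _ _ (st_plug E) (st_plug E')) => //.
- by case=> a s; rewrite /h /= odd_double /= uphalf_double.
- by move=> i _ /mapP [e _ ->]; rewrite /h /= odd_double.
Qed.

Lemma wslF_eq_stackA n (D1 D2 D3 : gauss n) :
  wslF_eq (stack D1 (stack D2 D3)) (stack (stack D1 D2) D3).
Proof.
apply/rst_sym/rst_step/Or31.
pose f (a : arrow) : arrow :=
  ((if odd a.1 then a.1.*2.+1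
    else if odd a.1./2 then a.1./2.*2.-1 else a.1./2)%N, a.2).
exists f; split=> //.
  move=> [a s] [b t] _ _ [ab ->]; congr pair; move: ab.
  by case: ifP; case: ifP; try (case: ifP); try (case: ifP); lia.
apply/ffunP => i; rewrite !ffunE !map_cat -!map_comp -!catA.
congr (_ ++ (_ ++ _)); apply: eq_map => -[[a s] b];
  rewrite /relabel /f /=; congr (_, _, _).
- by rewrite odd_double doubleK odd_double.
- by rewrite odd_double doubleK /= odd_double.
- by rewrite odd_double.
Qed.

Lemma wslF_eq_stack0 n (D : gauss n) : wslF_eq (stack (empty_gauss n) D) D.
Proof.
apply/rst_sym/rst_step/Or31; exists rgt; split=> //.
  by move=> a b _ _; apply: rgt_inj.
by apply/ffunP => i; rewrite !ffunE.
Qed.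

Lemma wslF_eq_stackr0 n (D : gauss n) : wslF_eq (stack D (empty_gauss n)) D.
Proof.
apply/rst_sym/rst_step/Or31; exists lft; split=> //.
  by move=> a b _ _; apply: lft_inj.
by apply/ffunP => i; rewrite !ffunE cats0.
Qed.

Definition wslF_eqb n : rel (gauss n) := fun D D' => `[< wslF_eq D D' >].

Lemma wslF_eqb_refl n : reflexive (@wslF_eqb n).
Proof. by move=> D; apply/asboolP/rst_refl. Qed.

Lemma wslF_eqb_sym n : symmetric (@wslF_eqb n).
Proof. by move=> D E; apply/asboolP/asboolP; apply: rst_sym. Qed.

Lemma wslF_eqb_trans n : transitive (@wslF_eqb n).
Proof.
move=> E D G /asboolP p /asboolP q; apply/asboolP.
exact: rst_trans p q.
Qed.

Canonical wslF_equiv n :=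
  EquivRel (@wslF_eqb n) (@wslF_eqb_refl n) (@wslF_eqb_sym n)
           (@wslF_eqb_trans n).

Definition wSLF (n : nat) : Type := {eq_quot wslF_equiv n}%qT.
HB.instance Definition _ n := Choice.on (wSLF n).
HB.instance Definition _ n := Quotient.on (wSLF n).
HB.instance Definition _ n := EqQuotient.on (wSLF n).

Definition wSLF_class n (D : gauss n) : wSLF n := (\pi_(wSLF n) D)%qT.

Definition wSLF_one n : wSLF n := wSLF_class (empty_gauss n).

Definition wSLF_mul n (x y : wSLF n) : wSLF n :=
  wSLF_class (stack (repr x) (repr y)).

Lemma wSLF_classP n (D D' : gauss n) :
  wSLF_class D = wSLF_class D' <-> wslF_eq D D'.
Proof.
split=> [/eqP|p]; first by rewrite eqmodE => /asboolP.
by apply/eqP; rewrite eqmodE; apply/asboolP.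
Qed.

Lemma wSLF_classK n (x : wSLF n) : wSLF_class (repr x) = x.
Proof. exact: reprK. Qed.

Lemma wSLF_classM n (D E : gauss n) :
  wSLF_mul (wSLF_class D) (wSLF_class E) = wSLF_class (stack D E).
Proof.
apply/wSLF_classP; apply: (rst_trans _ _ _ (stack D (repr (wSLF_class E)))).
  by apply: wslF_eq_stackl; apply/wSLF_classP/wSLF_classK.
by apply: wslF_eq_stackr; apply/wSLF_classP/wSLF_classK.
Qed.

Lemma wSLF_mulA n : associative (@wSLF_mul n).
Proof.
move=> x y z; rewrite -(wSLF_classK x) -(wSLF_classK y) -(wSLF_classK z).
by rewrite !wSLF_classM; apply/wSLF_classP/wslF_eq_stackA.
Qed.

Lemma wSLF_mul1 n : left_id (@wSLF_one n) (@wSLF_mul n).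
Proof.
move=> x; rewrite -(wSLF_classK x) wSLF_classM.
exact/wSLF_classP/wslF_eq_stack0.
Qed.

Lemma wSLF_mulr1 n : right_id (@wSLF_one n) (@wSLF_mul n).
Proof.
move=> x; rewrite -(wSLF_classK x) wSLF_classM.
exact/wSLF_classP/wslF_eq_stackr0.
Qed.

HB.instance Definition _ n :=
  isMonoid.Build (wSLF n) (@wSLF_mulA n) (@wSLF_mul1 n) (@wSLF_mulr1 n).

Definition offdiag (n : nat) : finType := {p : 'I_n * 'I_n | p.1 != p.2}.

Definition vlk n (D : gauss n) (i j : 'I_n) : int :=
  \sum_(a <- arrows D | (arrow_tail a \in D i) && (arrow_head a \in D j)) sgn a.2.

Definition vlks n (D : gauss n) : {ffun offdiag n -> int} :=
  [ffun p => vlk D (val p).1 (val p).2].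

(* Main.v *)
Require Import Defs.
From mathcomp Require Import all_boot all_order all_algebra.
From Stdlib Require Import Relations.
From HB Require Import structures.
From mathcomp Require Import zify.
Import GRing.Theory.
Local Open Scope ring_scope.

Set Implicit Arguments.
Unset Strict Implicit.
Unset Printing Implicit Defensive.

(** Invariance holds because R3, OC and F only permute endpoints inside
    strands ([vlks_strandwise_perm]), R1 concerns an arrow from a strand to
    itself, and R2 concerns two arrows of opposite signs between the same two
    strands.

    For the converse, the key fact is that modulo F a diagram only remembers on
    which strand each endpoint lies ([wslF_eq_strandwise_perm]).  This amounts to
    the exchange of any two adjacent endpoints ([swap_adjacent]): OC exchanges
    two tails, F a tail and a head, and the tail and head of one arrow are
    exchanged by deleting the arrow and inserting it again the other way with R1.
    Two heads are exchanged by R3 ([swap_heads_oriented]): if the arrows [a] and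
    [b] have adjacent heads, R2 creates two opposite arrows from the place of the
    tail of [a] to the place of the tail of [b]; one of them forms an R3
    configuration with [a] and [b], and after R3 the exchanges on its tail and on
    its head are undone by OC and F, so that R2 can remove the two arrows.

    Hence the monoid is commutative ([wSLF_mulC]) and generated by the
    one-arrow diagrams ([wslF_eq_factor]), whose classes [gen i j s] satisfy
    [gen i i s = 1] by R1 and [gen i j s * gen i j (~~ s) = 1] by R2.  So the map
    [realize], sending a family [c] of integers to the product of the
    [gen i j true] to the power [c (i, j)], inverts the linking numbers: peeling
    off the arrows of a diagram one by one and applying [realizeD1] shows that the
    class of [D] is [realize (vlks D)]. *)

(** * Words of endpoints, deletions and exchanges *)

Section WellFormed.
Variable n : nat.
Implicit Types (w : strands n) (D : gauss n) (x y e : endpoint) (a : arrow).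

Lemma gauss_inj D D' : strand D = strand D' -> D = D'.
Proof. exact: val_inj. Qed.

Lemma uniq_endpoints D : uniq (endpoints D).
Proof. by have /andP[] := gaussP D. Qed.

Lemma uniq_strand D i : uniq (D i).
Proof.
have := uniq_endpoints D; rewrite /endpoints codomE.
have: i \in enum 'I_n by rewrite mem_enum.
elim: (enum _) => //= k r IH; rewrite inE cat_uniq.
by case/predU1P => [->|/IH h] /and3P[] // _ _ /h.
Qed.

Lemma strand_unique D i j e : e \in D i -> e \in D j -> i = j.
Proof.
have := uniq_endpoints D; rewrite /endpoints codomE.
have: i \in enum 'I_n by rewrite mem_enum.
have: j \in enum 'I_n by rewrite mem_enum.
elim: (enum _) => //= k r IH; rewrite !inE cat_uniq.
case/predU1P => [->|jr]; case/predU1P => [->|ir] // /and3P[_ /hasPn dis ur] ei ej.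
- have /dis /negP[//] : e \in flatten [seq D i | i <- r] by apply/flatten_mapP; exists i.
- have /dis /negP[//] : e \in flatten [seq D i | i <- r] by apply/flatten_mapP; exists j.
exact: IH.
Qed.

Lemma opposite_endpoint D a s i :
  (a, s) \in D i -> exists j, (a, ~~ s) \in D j.
Proof.
move=> asD; apply/endpointsP; have /andP[_ /allP/(_ (a, s))] := gaussP D.
by apply; apply/endpointsP; exists i.
Qed.

Lemma perm_endpoints_wf w w' :
  perm_eq (endpoints w) (endpoints w') -> wf_strands w -> wf_strands w'.
Proof.
move=> p; rewrite /wf_strands -(perm_uniq p) -(perm_all _ p) => /andP[-> /allP h].
by apply/allP => e /h; rewrite (perm_mem p).
Qed.

Definition strandwise_perm w w' := forall i, perm_eq (w i) (w' i).

Lemma strandwise_perm_endpoints w w' :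
  strandwise_perm w w' -> perm_eq (endpoints w) (endpoints w').
Proof.
move=> p; rewrite /endpoints !codomE; elim: (enum _) => //= i r IH.
exact: perm_cat.
Qed.

Lemma strandwise_perm_wf w w' :
  strandwise_perm w w' -> wf_strands w -> wf_strands w'.
Proof. by move/strandwise_perm_endpoints/perm_endpoints_wf. Qed.

Lemma endpoints_delete A w :
  endpoints (delete A w) = [seq e <- endpoints w | e.1 \notin A].
Proof.
rewrite /endpoints !codomE; elim: (enum _) => //= i r IH.
by rewrite filter_cat ffunE IH.
Qed.

Lemma delete_wf A D : wf_strands (delete A D).
Proof.
have /andP[u /allP t] := gaussP D.
rewrite /wf_strands endpoints_delete filter_uniq //=.
apply/allP => e; rewrite !mem_filter /=.
by case/andP => -> /t ->.
Qed.

Lemma endpoints_map (f : endpoint -> endpoint) w :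
  endpoints (map_strands f w) = map f (endpoints w).
Proof.
rewrite /endpoints !codomE; elim: (enum _) => //= i r IH.
by rewrite map_cat ffunE IH.
Qed.

Lemma relabel_wf (f : arrow -> arrow) D :
  injective f -> wf_strands (map_strands (relabel f) D).
Proof.
move=> fI; have /andP[u /allP t] := gaussP D.
rewrite /wf_strands endpoints_map (map_inj_uniq (relabel_inj fI)) u /=.
apply/allP => _ /mapP[e /t et ->] /=.
by apply/mapP; exists (e.1, ~~ e.2).
Qed.

Lemma infix_map (T U : eqType) (f : T -> U) (s t : seq T) :
  infix s t -> infix (map f s) (map f t).
Proof.
case/infixP => u [v ->]; rewrite !map_cat; apply/infixP.
by exists (map f u), (map f v).
Qed.

Definition swap x y : endpoint -> endpoint := [eta id with x |-> y, y |-> x].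

Lemma swapK x y : involutive (swap x y).
Proof.
move=> e; rewrite /swap /=; case: (eqVneq e x) => [->|ex].
  by case: (eqVneq y x) => [->|_] //; rewrite ?eqxx.
case: (eqVneq e y) => [->|ey]; first by rewrite eqxx.
by rewrite (negbTE ex) (negbTE ey).
Qed.

Lemma swapC x y : swap x y =1 swap y x.
Proof. by move=> e; rewrite /swap /=; do 2 case: eqVneq => // ->. Qed.

Lemma swapL x y : swap x y x = y.
Proof. by rewrite /swap /= eqxx. Qed.

Lemma swapR x y : swap x y y = x.
Proof. by rewrite swapC swapL. Qed.

Lemma swap_id x y e : e != x -> e != y -> swap x y e = e.
Proof. by rewrite /swap /= => /negbTE-> /negbTE->. Qed.

Lemma exchangeC x y w : exchange x y w = exchange y x w.
Proof. by apply/ffunP => i; rewrite !ffunE; apply: eq_map; apply: swapC. Qed.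

(** The swap of two letters of a duplicate-free word is a permutation of that
    word, since it maps the set of its letters onto itself. *)
Lemma perm_swap x y (s : seq endpoint) :
  uniq s -> x \in s -> y \in s -> perm_eq s (map (swap x y) s).
Proof.
move=> us xs ys; apply: uniq_perm => //.
  by rewrite map_inj_uniq //; apply: can_inj (swapK x y).
have sub e : e \in s -> swap x y e \in s.
  by move=> es; rewrite /swap /=; case: eqP => // _; case: eqP.
move=> e; apply/idP/idP => [/sub es|/mapP[z /sub zs ->] //].
by apply/mapP; exists (swap x y e); rewrite ?swapK.
Qed.

Lemma exchange_perm D x y i :
  x \in D i -> y \in D i -> strandwise_perm D (exchange x y D).
Proof.
move=> xi yi k; rewrite ffunE.
case: (eqVneq k i) => [->|ki]; first exact: perm_swap (uniq_strand D i) xi yi.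
rewrite -/(swap x y) (_ : map _ _ = D k) //.
rewrite -[RHS]map_id; apply/eq_in_map => e ek; apply: swap_id.
  by apply: contra_neq ki => E; apply: strand_unique ek _; rewrite E.
by apply: contra_neq ki => E; apply: strand_unique ek _; rewrite E.
Qed.

Lemma precedes_strand D x y :
  precedes D x y -> exists i, x \in D i /\ y \in D i.
Proof.
case/existsP => i /infixP[u [v E]]; exists i.
by rewrite E !mem_cat !inE !eqxx !orbT.
Qed.

Lemma adjacent_strand D x y :
  adjacent D x y -> exists i, x \in D i /\ y \in D i.
Proof.
by case/orP => /precedes_strand[i [xi yi]]; exists i.
Qed.

Lemma adjacent_exchange_perm D x y :
  adjacent D x y -> strandwise_perm D (exchange x y D).
Proof. by case/adjacent_strand => i [xi yi]; apply: exchange_perm xi yi. Qed.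

Lemma adjacent_exchange_wf D x y :
  adjacent D x y -> wf_strands (exchange x y D).
Proof.
by move/adjacent_exchange_perm/strandwise_perm_wf; apply; apply: gaussP.
Qed.

Lemma adjacentC D x y : adjacent D x y = adjacent D y x.
Proof. by rewrite /adjacent orbC. Qed.

Lemma precedes_exchange D D' p q x y : strand D' = exchange p q D ->
  precedes D x y -> precedes D' (swap p q x) (swap p q y).
Proof.
move=> E /existsP[i /infix_map-/(_ _ (swap p q))] /= h.
by apply/existsP; exists i; rewrite E ffunE.
Qed.

Lemma adjacent_exchange D D' p q x y : strand D' = exchange p q D ->
  adjacent D x y -> adjacent D' (swap p q x) (swap p q y).
Proof.
by move=> E /orP[] /(precedes_exchange E) h; apply/orP; [left|right].
Qed.

(** Used for R1 on both sides of the exchange of the tail and head of one arrow. *)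
Lemma delete_exchange A x y w : x.1 \in A -> y.1 \in A ->
  delete A (exchange x y w) = delete A w.
Proof.
move=> xA yA; apply/ffunP => i; rewrite !ffunE -/(swap x y).
elim: (w i) => //= e s ->.
have [->|ex] := eqVneq e x; first by rewrite swapL xA yA.
have [->|ey] := eqVneq e y; first by rewrite swapR xA yA.
by rewrite swap_id.
Qed.

Lemma delete_exchangeC A x y w : x.1 \notin A -> y.1 \notin A ->
  delete A (exchange x y w) = exchange x y (delete A w).
Proof.
move=> xA yA; apply/ffunP => i; rewrite !ffunE -/(swap x y).
rewrite filter_map; congr map; apply: eq_filter => e /=.
have [->|ex] := eqVneq e x; first by rewrite swapL xA yA.
have [->|ey] := eqVneq e y; first by rewrite swapR xA yA.
by rewrite swap_id.
Qed.

End WellFormed.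

(** * Exchanging two adjacent endpoints *)

Lemma fresh_arrows n (D : gauss n) s :
  exists c c' : arrow, [/\ c.2 = s, c'.2 = ~~ s, c != c'
    & forall e, e \in endpoints D -> (e.1 != c) && (e.1 != c')].
Proof.
pose m := (\max_(e <- endpoints D) e.1.1).+1; exists (m, s), (m, ~~ s).
split=> //; first by rewrite xpair_eqE eqxx; case: s.
move=> e eD; have em : e.1.1 != m.
  by rewrite neq_ltn ltnS (@leq_bigmax_seq endpoint _ xpredT (fun e => e.1.1) _ eD).
by apply/andP; split; apply: contra_neq em => ->.
Qed.

Lemma infix_flatten (T : eqType) (s t : seq (seq T)) :
  infix s t -> infix (flatten s) (flatten t).
Proof.
case/infixP => u [v ->]; rewrite !flatten_cat; apply/infixP.
by exists (flatten u), (flatten v).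
Qed.

Lemma infix_mem (T : eqType) (x : T) (s : seq T) : x \in s -> infix [:: x] s.
Proof.
by case/splitPr => u v; apply/infixP; exists u, v.
Qed.

Section Swaps.
Variable n : nat.
Implicit Types (w : strands n) (D : gauss n) (x y e : endpoint) (a : arrow).

Lemma swap_tails D D' a b : adjacent D (arrow_tail a) (arrow_tail b) ->
  strand D' = exchange (arrow_tail a) (arrow_tail b) D -> wslF_eq D D'.
Proof. by move=> adj E; apply/rst_step/Or32/Or44; exists a, b. Qed.

(** F covers distinct arrows.  An arrow with adjacent endpoints is deleted by R1
    on either side of the exchange, with the same result. *)
Lemma swap_tail_head D D' a b : adjacent D (arrow_tail a) (arrow_head b) ->
  strand D' = exchange (arrow_tail a) (arrow_head b) D -> wslF_eq D D'.
Proof.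
have [->|ab] := eqVneq a b => adj E; last by apply/rst_step/Or33; exists a, b.
pose D0 := Gauss (delete_wf [:: b] D).
apply: (rst_trans _ _ _ D0); first by apply/rst_step/Or32/Or41; exists b.
apply/rst_sym/rst_step/Or32/Or41; exists b; split.
  by rewrite adjacentC; have := adjacent_exchange E adj; rewrite swapL swapR.
by rewrite E /= delete_exchange //= inE.
Qed.

(** The inverse of R2 inserts endpoints next to given ones; replacing each letter
    by a word performs both insertions at once, even when they are made on the
    same strand. *)
Definition expand (g : endpoint -> seq endpoint) w : strands n :=
  [ffun i => flatten (map g (w i))].

Lemma endpoints_expand g w : endpoints (expand g w) = flatten (map g (endpoints w)).
Proof.
rewrite /endpoints !codomE; elim: (enum _) => //= i r IH.
by rewrite map_cat flatten_cat ffunE IH.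
Qed.

Lemma precedes_expand_in g D D1 e x y : strand D1 = expand g D ->
  e \in endpoints D -> infix [:: x; y] (g e) -> precedes D1 x y.
Proof.
move=> E /endpointsP[i /infix_mem/(infix_map g)/infix_flatten h] xy.
apply/existsP; exists i; rewrite E ffunE; apply: infix_trans xy _.
by rewrite /= cats0 in h.
Qed.

Lemma precedes_expand g D D1 x y : strand D1 = expand g D ->
  g x = [:: x] -> g y = [:: y] -> precedes D x y -> precedes D1 x y.
Proof.
move=> E gx gy /existsP[i /(infix_map g)/infix_flatten h].
by apply/existsP; exists i; rewrite E ffunE; move: h; rewrite /= gx gy.
Qed.

Lemma delete_expand g A D :
  (forall e, e \in endpoints D -> [seq e' <- g e | e'.1 \notin A] = [:: e]) ->
  delete A (expand g D) = D.
Proof.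
move=> gA; apply/ffunP => i; rewrite !ffunE filter_flatten -map_comp.
rewrite -[RHS]flatten_seq1; congr flatten; apply/eq_in_map => e ei /=.
by apply: gA; apply/endpointsP; exists i.
Qed.

(** The auxiliary arrows [c] and [c'] of opposite signs run from just after the
    tail of [a] to the tail of [b], and the R3 configuration is made of [c], [b]
    and [a], in the roles of the arrows 1 to 2, 2 to 3 and 1 to 3.  With
    [eta1 = eta3 = true], the sign conditions of R3 say that [c] has the sign of
    [b] and that [eta2] is positive exactly when the signs of [a] and [b]
    differ; this [eta2] is [eta] below, and it decides on which side of the tail
    of [b] the heads of [c] and [c'] are inserted. *)
Lemma swap_heads_oriented D D' b a :
  precedes D (arrow_head b) (arrow_head a) -> a != b ->
  strand D' = exchange (arrow_head b) (arrow_head a) D -> wslF_eq D D'.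
Proof.
move=> prec ab E.
have [c [c' [cs c's cc' fresh]]] := fresh_arrows D b.2.
pose eta := a.2 != b.2.
pose g e : seq endpoint :=
  if e == arrow_tail a then [:: arrow_tail a; arrow_tail c; arrow_tail c']
  else if e == arrow_tail b then
    if eta then [:: arrow_head c'; arrow_head c; arrow_tail b]
    else [:: arrow_tail b; arrow_head c; arrow_head c']
  else [:: e].
have gh d : g (arrow_head d) = [:: arrow_head d].
  by rewrite /g !xpair_eqE !andbF.
have gta : g (arrow_tail a) = [:: arrow_tail a; arrow_tail c; arrow_tail c'].
  by rewrite /g eqxx.
have tab : (arrow_tail b == arrow_tail a) = false.
  by rewrite xpair_eqE /= andbT eq_sym; apply/negbTE.
have gtb : g (arrow_tail b) =
    if eta then [:: arrow_head c'; arrow_head c; arrow_tail b]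
    else [:: arrow_tail b; arrow_head c; arrow_head c'].
  by rewrite /g tab eqxx.
have [i [hbi hai]] := precedes_strand prec.
have [ja taj] := opposite_endpoint hai; have [jb tbj] := opposite_endpoint hbi.
have taD : arrow_tail a \in endpoints D by apply/endpointsP; exists ja.
have tbD : arrow_tail b \in endpoints D by apply/endpointsP; exists jb.
have /andP[ac ac'] := fresh _ taD; have /andP[bc bc'] := fresh _ tbD.
rewrite /= in ac ac' bc bc'.
have wf1 : wf_strands (expand g D).
  have pD : perm_eq (endpoints (expand g D))
      ([:: arrow_tail c; arrow_tail c'; arrow_head c; arrow_head c'] ++ endpoints D).
    pose r := rem (arrow_tail b) (rem (arrow_tail a) (endpoints D)).
    have pr : perm_eq (endpoints D) [:: arrow_tail a, arrow_tail b & r].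
      apply: perm_trans (perm_to_rem taD) _; rewrite perm_cons; apply: perm_to_rem.
      by rewrite mem_rem_uniq ?uniq_endpoints // inE tab tbD.
    have gr : flatten (map g r) = r.
      have := uniq_endpoints D; rewrite (perm_uniq pr) /= inE.
      case/and3P => /norP[_ /negP ar] /negP br _.
      rewrite -[RHS]flatten_seq1; congr flatten; apply/eq_in_map => e er.
      rewrite /g; case: eqP => [ea|_]; first by rewrite -ea in ar.
      by case: eqP => [eb|_] //; rewrite -eb in br.
    rewrite endpoints_expand.
    apply: perm_trans (perm_flatten (perm_map g pr)) _; rewrite /= gta gtb gr.
    apply: (@perm_trans _ ([:: arrow_tail c; arrow_tail c'; arrow_head c; arrow_head c']
      ++ [:: arrow_tail a, arrow_tail b & r])); last first.
      by rewrite perm_cat2l perm_sym.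
    by apply/permP => p; case: (eta) => /=; clear; lia.
  have /andP[u /allP t] := gaussP D.
  rewrite /wf_strands (perm_uniq pD) (perm_all _ pD) cat_uniq u /=.
  rewrite !(perm_mem pD) !inE !xpair_eqE !eqxx (eq_sym c') (negbTE cc') /= ?orbT ?andbT /=.
  apply/andP; split; last first.
    by apply/allP => e /t eD; rewrite (perm_mem pD) mem_cat eD orbT.
  apply/hasPn => -[d s] /fresh /andP[/= dc dc'].
  by rewrite !inE !xpair_eqE (negbTE dc) (negbTE dc').
have [D1 E1] : exists D1 : gauss n, strand D1 = expand g D by exists (Gauss wf1).
have del1 : delete [:: c; c'] D1 = D.
  rewrite E1; apply: delete_expand => e /fresh /andP[ec ec'].
  rewrite /g; case: eqP => [->|_].
    by rewrite /= !inE !eqxx orbT (negbTE ac) (negbTE ac').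
  case: eqP => [->|_].
    by case: (eta); rewrite /= !inE !eqxx orbT (negbTE bc) (negbTE bc').
  by rewrite /= !inE (negbTE ec) (negbTE ec').
have tacc' : infix [:: arrow_tail a; arrow_tail c] (g (arrow_tail a)).
  by rewrite gta; apply/infixP; exists [::], [:: arrow_tail c'].
have tcc' : infix [:: arrow_tail c; arrow_tail c'] (g (arrow_tail a)).
  by rewrite gta; apply/infixP; exists [:: arrow_tail a], [::].
have adjt1 : adjacent D1 (arrow_tail c) (arrow_tail c').
  by rewrite /adjacent (precedes_expand_in E1 taD tcc').
have adjh1 : adjacent D1 (arrow_head c) (arrow_head c').
  case: (eta) gtb => gtb'; apply/orP; [right|left];
    apply: (precedes_expand_in E1 tbD); rewrite gtb'; apply/infixP.
    by exists [::], [:: arrow_tail b].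
  by exists [:: arrow_tail b], [::].
have p1 : portion D1 true (arrow_tail a) (arrow_tail c).
  exact: precedes_expand_in E1 taD tacc'.
have p2 : portion D1 eta (arrow_head c) (arrow_tail b).
  rewrite /portion; case: (eta) gtb => gtb';
    apply: (precedes_expand_in E1 tbD); rewrite gtb'; apply/infixP.
    by exists [:: arrow_head c'], [::].
  by exists [::], [:: arrow_head c'].
have p3 : portion D1 true (arrow_head b) (arrow_head a).
  exact: precedes_expand E1 (gh b) (gh a) prec.
have adj_ba : adjacent D1 (arrow_head b) (arrow_head a) by apply/orP; left.
have adj_cb : adjacent D1 (arrow_head c) (arrow_tail b).
  by rewrite /adjacent; case: (eta) p2 => /= ->; rewrite ?orbT.
have adj_ac : adjacent D1 (arrow_tail a) (arrow_tail c).
  by apply/orP; left.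
have neq d d' s s' : d != d' -> ((d, s) : endpoint) != (d', s').
  by apply: contra_neq => -[].
(* R3 turns [D1] into [D2].  The diagram [D3], where only the heads of [a] and
   [b] are exchanged, is reached from [D2] by undoing an OC and an F move. *)
pose D3 := Gauss (adjacent_exchange_wf adj_ba).
have adj3 x y : swap (arrow_head b) (arrow_head a) x = x ->
    swap (arrow_head b) (arrow_head a) y = y -> adjacent D1 x y -> adjacent D3 x y.
  by move=> {2}<- {2}<-; apply: adjacent_exchange.
have sc s : swap (arrow_head b) (arrow_head a) (c, s) = (c, s).
  by apply: swap_id; apply: neq; rewrite eq_sym.
have sc' s : swap (arrow_head b) (arrow_head a) (c', s) = (c', s).
  by apply: swap_id; apply: neq; rewrite eq_sym.
have st d : swap (arrow_head b) (arrow_head a) (arrow_tail d) = arrow_tail d.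
  by apply: swap_id; rewrite xpair_eqE andbF.
pose D4 := Gauss (adjacent_exchange_wf (adj3 _ _ (sc _) (st _) adj_cb)).
have adj4 : adjacent D4 (arrow_tail a) (arrow_tail c).
  have := adjacent_exchange (erefl (strand D4)) (adj3 _ _ (st _) (st _) adj_ac).
  by rewrite !swap_id ?xpair_eqE ?andbF ?andbT //= 1?eq_sym.
pose D2 := Gauss (adjacent_exchange_wf adj4).
apply: (rst_trans _ _ _ D1).
  by apply/rst_sym/rst_step/Or32/Or42; exists c, c'; split=> //; rewrite cs c's negbK.
apply: (rst_trans _ _ _ D2).
  apply/rst_step/Or32/Or43; exists c, b, a, true, eta, true; split => //.
  - by rewrite /= !inE !(eq_sym c) (eq_sym b a) (negbTE ac) (negbTE bc) (negbTE ab).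
  - by rewrite cs; case: (b.2); case: (eta).
  by rewrite /eta; case: (a.2); case: (b.2).
apply: (rst_trans _ _ _ D4); first exact/rst_sym/(swap_tails adj4).
apply: (rst_trans _ _ _ D3).
  apply/rst_sym/(@swap_tail_head _ _ b c); last by rewrite exchangeC.
  by rewrite adjacentC; exact: adj3 (sc _) (st _) adj_cb.
apply/rst_step/Or32/Or42; exists c, c'; split.
- by rewrite cs c's negbK.
- exact: adj3 (sc _) (sc' _) adjt1.
- exact: adj3 (sc _) (sc' _) adjh1.
rewrite E /= delete_exchangeC ?del1 //= !inE negb_or; first by rewrite bc.
by rewrite ac.
Qed.

Lemma swap_adjacent D D' x y :
  adjacent D x y -> strand D' = exchange x y D -> wslF_eq D D'.
Proof.
case: x y => [a []] [b []] adj E.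
- have [ab|ab] := eqVneq a b.
    suff -> : D' = D by apply: rst_refl.
    apply: gauss_inj; rewrite E ab; apply/ffunP => i; rewrite ffunE -[RHS]map_id.
    by apply: eq_map => e /=; case: eqP.
  case/orP: adj => prec; first by apply: swap_heads_oriented prec _ E; rewrite eq_sym.
  by apply: swap_heads_oriented prec ab _; rewrite exchangeC.
- by apply: (@swap_tail_head _ _ b a); rewrite 1?adjacentC // exchangeC.
- exact: swap_tail_head adj E.
exact: swap_tails adj E.
Qed.

End Swaps.

(** * Diagrams with the same endpoints on each strand *)

Section StrandwisePermutations.
Variable n : nat.
Implicit Types (w : strands n) (D : gauss n) (x y e : endpoint) (a : arrow).
Implicit Types (u v s t : seq endpoint).

Definition set_strand w i s : strands n := [ffun k => if k == i then s else w k].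

Lemma set_strand_id w i : set_strand w i (w i) = w.
Proof. by apply/ffunP => k; rewrite ffunE; case: eqP => [->|]. Qed.

Lemma set_strandK w i s t : set_strand (set_strand w i s) i t = set_strand w i t.
Proof. by apply/ffunP => k; rewrite !ffunE; case: eqP. Qed.

Lemma set_strand_perm w i s : perm_eq (w i) s -> strandwise_perm w (set_strand w i s).
Proof. by move=> p k; rewrite ffunE; case: eqP => [->|]. Qed.

Lemma exchange_consecutive D i u x y v : D i = u ++ x :: y :: v ->
  exchange x y D = set_strand D i (u ++ y :: x :: v).
Proof.
move=> E; have xi : x \in D i by rewrite E mem_cat inE eqxx orbT.
have yi : y \in D i by rewrite E mem_cat !inE eqxx !orbT.
apply/ffunP => k; rewrite !ffunE -/(swap x y).
have [->|ki] := eqVneq k i; last first.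
  rewrite -[RHS]map_id; apply/eq_in_map => e ek; apply: swap_id;
  by apply: contra_neq ki => E'; apply: strand_unique ek _; rewrite E'.
have := uniq_strand D i; rewrite E cat_uniq /= !inE !negb_or -!andbA.
case/and5P => _ xu yu _ /and4P[_ xv yv _].
have fix_ s : x \notin s -> y \notin s -> map (swap x y) s = s.
  move=> xs ys; rewrite -[RHS]map_id; apply/eq_in_map => e es.
  by apply: swap_id; apply: contraTneq es => ->.
by rewrite map_cat /= swapL swapR !fix_.
Qed.

Lemma wslF_eq_move_endpoint D D' i u s x v : D i = u ++ s ++ x :: v ->
  strand D' = set_strand D i (u ++ x :: s ++ v) -> wslF_eq D D'.
Proof.
elim/last_ind: s D v => [|s y IH] D v E E'.
  suff -> : D' = D by apply: rst_refl.
  by apply: gauss_inj; rewrite E' -[RHS](set_strand_id _ i) E.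
rewrite cat_rcons catA in E.
have adj : adjacent D y x.
  apply/orP; left; apply/existsP; exists i; rewrite E.
  exact: (infix_infix _ [:: y; x]).
pose D2 := Gauss (adjacent_exchange_wf adj).
have E2 : strand D2 = set_strand D i ((u ++ s) ++ x :: y :: v).
  exact: exchange_consecutive.
apply: (rst_trans _ _ _ D2); first by apply: (swap_adjacent adj).
apply: (IH _ (y :: v)); first by rewrite E2 ffunE eqxx catA.
by rewrite E2 set_strandK E' cat_rcons.
Qed.

(** The prefix [u] grows in the induction: the first letter of [s] is brought to
    the front of [t], after which it belongs to the common prefix. *)
Lemma wslF_eq_set_strand D D' i u s t : perm_eq s t -> D i = u ++ s ->
  strand D' = set_strand D i (u ++ t) -> wslF_eq D D'.
Proof.
elim: s t u D D' => [|x s IH] t u D D' st E E'.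
  suff -> : D' = D by apply: rst_refl.
  apply: gauss_inj; rewrite E' -[RHS](set_strand_id _ i) E.
  by rewrite perm_sym in st; rewrite (perm_nilP st).
have xt : x \in t by rewrite -(perm_mem st) inE eqxx.
case/splitPr: xt st E' => t1 t2 st E'.
have st' : perm_eq s (t1 ++ t2).
  by rewrite -(perm_cons x) (perm_trans st) // perm_catC /= perm_cons perm_catC.
have wf2 : wf_strands (set_strand D i (u ++ x :: t1 ++ t2)).
  apply: strandwise_perm_wf (gaussP D); apply: set_strand_perm.
  by rewrite E perm_cat2l perm_cons.
apply: (rst_trans _ _ _ (Gauss wf2)).
  by apply: (IH (t1 ++ t2) (rcons u x)); rewrite //= cat_rcons.
apply/rst_sym/(@wslF_eq_move_endpoint _ _ i u t1 x t2); rewrite E' /=.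
  by rewrite ffunE eqxx.
by rewrite set_strandK.
Qed.

(** The strands are replaced one after the other; the intermediate diagrams are
    well formed because their strands have the same endpoints as those of [D]. *)
Lemma wslF_eq_strandwise_perm D D' : strandwise_perm D D' -> wslF_eq D D'.
Proof.
move=> p; pose w (r : seq 'I_n) : strands n := [ffun i => if i \in r then D' i else D i].
have pw r : strandwise_perm D (w r) by move=> i; rewrite ffunE; case: ifP.
pose G r := Gauss (strandwise_perm_wf (pw r) (gaussP D)).
have -> : D' = G (enum 'I_n).
  by apply: gauss_inj; apply/ffunP => i; rewrite ffunE mem_enum.
elim: (enum _) => [|i r IH].
  suff -> : G [::] = D by apply: rst_refl.
  by apply: gauss_inj; apply/ffunP => i; rewrite ffunE.
apply: rst_trans IH _; apply: (@wslF_eq_set_strand _ _ i [::] (G r i) (D' i)) => //.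
  by rewrite ffunE; case: ifP.
by apply/ffunP => k; rewrite !ffunE inE; case: eqP => [->|].
Qed.

End StrandwisePermutations.

(** * Invariance of the linking numbers *)

Section Invariance.
Variable n : nat.
Implicit Types (w : strands n) (D : gauss n) (x y e : endpoint) (a : arrow).

(** The linking number read off the words of the source and target strands, by
    summing over the tails in the source instead of over the arrows. *)
Definition word_vlk (s t : seq endpoint) : int :=
  \sum_(e <- s | ~~ e.2 && (arrow_head e.1 \in t)) sgn e.1.2.

Lemma vlkE D i j : vlk D i j = word_vlk (D i) (D j).
Proof.
rewrite /vlk /word_vlk -big_filter -[RHS]big_filter -(big_map fst xpredT (fun a => sgn a.2)).
apply: perm_big; apply: uniq_perm.
- by rewrite filter_uniq ?undup_uniq.
- rewrite map_inj_in_uniq ?filter_uniq ?uniq_strand // => -[a s] [b t].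
  by rewrite !mem_filter /= => /andP[/andP[/negbTE-> _] _] /andP[/andP[/negbTE-> _] _] ->.
move=> a; rewrite mem_filter mem_undup; apply/idP/idP.
  case/andP => /andP[ti hj] _; apply/mapP; exists (arrow_tail a) => //.
  by rewrite mem_filter /= hj.
case/mapP => -[b s]; rewrite mem_filter /= => /andP[/andP[/negbTE-> hj] ti] ->.
rewrite ti hj /=; apply/mapP; exists (arrow_tail b) => //.
by apply/endpointsP; exists i.
Qed.

Lemma word_vlk_perm (s t s' t' : seq endpoint) :
  perm_eq s s' -> perm_eq t t' -> word_vlk s t = word_vlk s' t'.
Proof.
move=> p q; rewrite /word_vlk (perm_big _ p); apply: eq_bigl => e.
by rewrite (perm_mem q).
Qed.

Lemma vlks_strandwise_perm D D' : strandwise_perm D D' -> vlks D = vlks D'.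
Proof.
by move=> p; apply/ffunP => q; rewrite !ffunE !vlkE; apply: word_vlk_perm.
Qed.

Lemma word_vlk_relabel (f : arrow -> arrow) (s t : seq endpoint) :
  (forall e e', e \in s -> e' \in t -> f e.1 = f e'.1 -> e.1 = e'.1) ->
  (forall e, e \in s -> (f e.1).2 = e.1.2) ->
  word_vlk (map (relabel f) s) (map (relabel f) t) = word_vlk s t.
Proof.
move=> fI fS; rewrite /word_vlk big_map big_seq_cond [RHS]big_seq_cond.
apply: eq_big => [e /=|e /andP[es _]]; last by rewrite /= fS.
apply: andb_id2l => es; congr andb; apply/mapP/idP => [[[b s'] bt]|ht].
  case=> fab; move: bt => /[swap] <- bt; have /= -> := fI _ _ es bt fab.
  by [].
by exists (arrow_head e.1).
Qed.

Lemma vlks_iso D D' : gauss_iso D D' -> vlks D = vlks D'.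
Proof.
case=> f [fI fS E]; apply/ffunP => q; rewrite !ffunE !vlkE E !ffunE.
have arr i e : e \in D i -> e.1 \in arrows D.
  by move=> ei; rewrite mem_undup; apply: map_f; apply/endpointsP; exists i.
rewrite word_vlk_relabel // => [e e' /arr eD /arr e'D|e /arr eD]; first exact: fI.
exact: fS.
Qed.

(** Covers R1 and R2 together: only the deleted arrows from strand [i] to strand
    [j] contribute to the difference. *)
Lemma vlk_delete A D D' i j : uniq A -> strand D' = delete A D ->
  vlk D i j = vlk D' i j
    + \sum_(a <- A | (arrow_tail a \in D i) && (arrow_head a \in D j)) sgn a.2.
Proof.
move=> uA E; rewrite !vlkE E !ffunE /word_vlk.
rewrite [LHS](bigID (fun e : endpoint => e.1 \notin A)) /=; congr (_ + _).
  rewrite big_filter_cond; apply: eq_bigl => e; rewrite mem_filter /=.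
  by case: (e.1 \in A); rewrite ?andbF ?andbT.
rewrite -big_filter -[RHS]big_filter -(big_map arrow_tail xpredT (fun e => sgn e.1.2)).
apply: perm_big; apply: uniq_perm.
- by rewrite filter_uniq ?uniq_strand.
- by rewrite map_inj_uniq ?filter_uniq // => a b [].
move=> [a s]; rewrite mem_filter /= negbK; apply/idP/mapP.
  case: s => //= /andP[/andP[hj aA] ti]; exists a => //.
  by rewrite mem_filter ti hj aA.
by case=> b; rewrite mem_filter => /andP[/andP[ti hj] bA] [-> ->] /=; rewrite hj bA.
Qed.

Lemma vlks_R1 D D' : R1_move D D' -> vlks D = vlks D'.
Proof.
case=> a [/adjacent_strand[k [tk hk]] E]; apply/ffunP => -[[i j] ij]; rewrite !ffunE /=.
rewrite (vlk_delete _ _ (isT : uniq [:: a]) E) big_cons big_nil addr0.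
case: ifP => [/andP[ti hj]|_]; last by rewrite addr0.
by move: ij; rewrite /= (strand_unique ti tk) (strand_unique hj hk) eqxx.
Qed.

Lemma vlks_R2 D D' : R2_move D D' -> vlks D = vlks D'.
Proof.
case=> a [b [sab /adjacent_strand[k [tak tbk]] /adjacent_strand[l [hal hbl]] E]].
have ab : uniq [:: a; b].
  by rewrite /= inE andbT; apply: contra_eq_neq sab => ->; case: (b.2).
have on e k' i : e \in D k' -> (e \in D i) = (i == k').
  by move=> ek; apply/idP/eqP => [ei|->] //; apply: strand_unique ei ek.
apply/ffunP => -[[i j] ij]; rewrite !ffunE /= (vlk_delete _ _ ab E).
rewrite !big_cons big_nil !addr0.
rewrite (on _ _ i tak) (on _ _ i tbk) (on _ _ j hal) (on _ _ j hbl) sab.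
rewrite -[RHS]addr0; congr (_ + _).
by case: (_ && _); case: (b.2).
Qed.

Lemma vlks_exchange D D' x y :
  adjacent D x y -> strand D' = exchange x y D -> vlks D = vlks D'.
Proof.
by move=> adj E; apply: vlks_strandwise_perm; rewrite E; apply: adjacent_exchange_perm.
Qed.

Lemma strandwise_perm_trans w w' w'' :
  strandwise_perm w w' -> strandwise_perm w' w'' -> strandwise_perm w w''.
Proof. by move=> p q i; apply: perm_trans (p i) (q i). Qed.

Lemma portion_adjacent D eta x y : portion D eta x y -> adjacent D x y.
Proof. by rewrite /adjacent; case: eta => /= ->; rewrite ?orbT. Qed.

Lemma vlks_R3 D D' : R3_move D D' -> vlks D = vlks D'.
Proof.
case=> a [b [c [e1 [e2 [e3 [_ [p1 p2 p3] _ _ E]]]]]].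
apply: vlks_strandwise_perm; rewrite E.
have strandP eta x y : portion D eta x y -> exists i, x \in D i /\ y \in D i.
  by move/portion_adjacent/adjacent_strand.
have [i [x1 y1]] := strandP _ _ _ p1.
have [j [x2 y2]] := strandP _ _ _ p2.
have [k [x3 y3]] := strandP _ _ _ p3.
have q3 := exchange_perm x3 y3; pose D3 := Gauss (strandwise_perm_wf q3 (gaussP D)).
have q2 : strandwise_perm D (exchange (arrow_head a) (arrow_tail b) D3).
  apply: (strandwise_perm_trans q3).
  by apply: (@exchange_perm _ D3 _ _ j); rewrite /= -(perm_mem (q3 j)).
pose D2 := Gauss (strandwise_perm_wf q2 (gaussP D)).
apply: (strandwise_perm_trans q2).
by apply: (@exchange_perm _ D2 _ _ i); rewrite /= -(perm_mem (q2 i)).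
Qed.

Lemma vlks_welded D D' : welded_move D D' -> vlks D = vlks D'.
Proof.
case; [exact: vlks_R1|exact: vlks_R2|exact: vlks_R3|].
by case=> a [b [adj E]]; apply: vlks_exchange adj E.
Qed.

Lemma vlks_F D D' : F_move D D' -> vlks D = vlks D'.
Proof. by case=> a [b [_ adj E]]; apply: vlks_exchange adj E. Qed.

Lemma vlks_wslF_eq D D' : wslF_eq D D' -> vlks D = vlks D'.
Proof.
elim=> {D D'} [D D' []|//|//|D E G _ -> _ ->] //.
- exact: vlks_iso.
- exact: vlks_welded.
exact: vlks_F.
Qed.

(** No cross terms appear because no arrow joins one pair of words to the other. *)
Lemma word_vlk_cat (s1 s2 t1 t2 : seq endpoint) :
  (forall e, e \in s1 -> arrow_head e.1 \notin t2) ->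
  (forall e, e \in s2 -> arrow_head e.1 \notin t1) ->
  word_vlk (s1 ++ s2) (t1 ++ t2) = word_vlk s1 t1 + word_vlk s2 t2.
Proof.
move=> st st'; rewrite /word_vlk big_cat /=; congr (_ + _).
  rewrite big_seq_cond [RHS]big_seq_cond; apply: eq_bigl => e.
  by apply: andb_id2l => /st/negbTE h; rewrite mem_cat h orbF.
rewrite big_seq_cond [RHS]big_seq_cond; apply: eq_bigl => e.
by apply: andb_id2l => /st'/negbTE h; rewrite mem_cat h.
Qed.

Lemma vlks_stack D E : vlks (stack D E) = vlks D + vlks E.
Proof.
apply/ffunP => q; rewrite !ffunE !vlkE !ffunE word_vlk_cat.
- by rewrite !word_vlk_relabel // => e e' _ _; [apply: rgt_inj|apply: lft_inj].
- by move=> _ /mapP[e _ ->]; apply/mapP => -[e' _ []] /=; lia.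
by move=> _ /mapP[e _ ->]; apply/mapP => -[e' _ []] /=; lia.
Qed.

End Invariance.

(** * The monoid is commutative and generated by one-arrow diagrams *)

Lemma flatten_indicator (I : eqType) (T : Type) (r : seq I) (i : I) (e : T) :
  uniq r -> i \in r ->
  flatten [seq if k == i then [:: e] else [::] | k <- r] = [:: e].
Proof.
elim: r => //= k r IH /andP[kr ur]; rewrite inE eq_sym; case: eqP => [<- _|_ ir] /=.
  congr cons; elim: r kr {IH ur} => //= l r IH; rewrite inE negb_or eq_sym.
  by case/andP => /negbTE -> /IH.
exact: IH.
Qed.

Section Generators.
Variable n : nat.
Implicit Types (D E : gauss n) (x y : wSLF n) (i j k : 'I_n) (s : bool).

Definition single_strands i j s : strands n :=
  [ffun k => (if k == i then [:: arrow_tail (0%N, s)] else [::])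
          ++ (if k == j then [:: arrow_head (0%N, s)] else [::])].

Lemma single_wf i j s : wf_strands (single_strands i j s).
Proof.
have p : perm_eq [:: arrow_tail (0%N, s); arrow_head (0%N, s)]
                 (endpoints (single_strands i j s)).
  rewrite perm_sym /endpoints codomE (eq_map (ffunE _)).
  apply: perm_trans (@perm_flatten_cat 'I_n endpoint _ _ _) _.
  by rewrite !flatten_indicator ?mem_enum ?enum_uniq.
by rewrite /wf_strands -(perm_uniq p) -(perm_all _ p) /= -!(perm_mem p) !inE !xpair_eqE !eqxx ?andbF ?orbT.
Qed.

Definition single i j s : gauss n := Gauss (single_wf i j s).

Definition dirac i j s : {ffun offdiag n -> int} :=
  [ffun p => if val p == (i, j) then sgn s else 0].

Lemma vlks_single i j s : vlks (single i j s) = dirac i j s.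
Proof.
apply/ffunP => -[[k l] kl]; rewrite !ffunE /= vlkE !ffunE /word_vlk xpair_eqE.
rewrite big_cat /=.
have -> : \sum_(e <- if k == j then [:: arrow_head (0%N, s)] else [::]
  | ~~ e.2 && (arrow_head e.1 \in
                 (if l == i then [:: arrow_tail (0%N, s)] else [::])
                 ++ (if l == j then [:: arrow_head (0%N, s)] else [::])))
  sgn e.1.2 = 0 :> int.
  by case: ifP => _; rewrite ?big_cons big_nil.
rewrite addr0; case: eqP => [_|_]; last by rewrite big_nil.
rewrite big_cons big_nil addr0 /= mem_cat.
case: (l == i); case: (l == j); rewrite ?inE ?xpair_eqE ?eqxx ?andbF ?orbT //.
Qed.

(** Renaming [a] to the name it has in the first factor, and the other arrows as
    in the second factor, leaves on each strand the endpoints of the stacking, so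
    that only their order differs. *)
Lemma wslF_eq_factor D a i j :
  arrow_tail a \in D i -> arrow_head a \in D j ->
  wslF_eq D (stack (single i j a.2) (Gauss (delete_wf [:: a] D))).
Proof.
move=> ti hj.
pose f b : arrow := if b == a then (0%N, a.2) else rgt b.
have fI : injective f.
  move=> b c; rewrite /f; case: eqP => [->|_]; case: eqP => [->|_] //.
  exact: rgt_inj.
pose D1 := Gauss (relabel_wf D fI).
apply: (rst_trans _ _ _ D1).
  apply/rst_step/Or31; exists f; split=> // [b c _ _|b _]; first exact: fI.
  by rewrite /f; case: eqP => [->|].
apply: wslF_eq_strandwise_perm => k; rewrite !ffunE /=.
have pk : perm_eq (D k) ([seq e <- D k | e.1 == a] ++ [seq e <- D k | e.1 != a]).
  by rewrite perm_sym; apply/permPl/(perm_filterC (fun e : endpoint => e.1 == a)).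
apply: perm_trans (perm_map _ pk) _; rewrite [X in perm_eq X _]map_cat; apply: perm_cat.
  have q : perm_eq [seq e <- D k | e.1 == a]
    ((if k == i then [:: arrow_tail a] else [::])
     ++ (if k == j then [:: arrow_head a] else [::])).
    apply: uniq_perm; first by rewrite filter_uniq ?uniq_strand.
      by case: (k == i); case: (k == j); rewrite //= inE xpair_eqE andbF.
    move=> [b s]; rewrite mem_filter mem_cat /=.
    have on e l : e \in D l -> (e \in D k) = (k == l).
      by move=> el; apply/idP/eqP => [ek|->] //; apply: strand_unique ek el.
    have [->|ba] := eqVneq b a; last first.
      by case: ifP => _; case: ifP => _; rewrite ?inE ?xpair_eqE ?(negbTE ba).
    case: s; rewrite /= ?(on _ _ ti) ?(on _ _ hj).
      by case: (k == i); case: (k == j); rewrite ?inE ?xpair_eqE ?eqxx ?andbF.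
    by case: (k == i); case: (k == j); rewrite ?inE ?xpair_eqE ?eqxx ?andbF.
  apply: perm_trans (perm_map _ q) _; rewrite !map_cat.
  by case: (k == i); case: (k == j); rewrite //= /relabel /f /= eqxx.
rewrite (eq_filter (a2 := fun e : endpoint => e.1 \notin [:: a])); last first.
  by move=> e; rewrite /= inE.
have -> // : map (relabel f) [seq e <- D k | e.1 \notin [:: a]] =
             map (relabel rgt) [seq e <- D k | e.1 \notin [:: a]].
apply/eq_in_map => e; rewrite mem_filter inE => /andP[ea _].
by rewrite /relabel /f (negbTE ea).
Qed.

(** After renaming, [stack D E] and [stack E D] have the same endpoints on each
    strand. *)
Lemma wSLF_mulC : commutative (@wSLF_mul n).
Proof.
move=> x y; rewrite -(wSLF_classK x) -(wSLF_classK y) !wSLF_classM.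
move: (repr x) (repr y) => D E; apply/wSLF_classP.
(* Stacking uses even names below and odd names above: exchange 2k and 2k+1. *)
pose f (b : arrow) : arrow := ((if odd b.1 then b.1.-1 else b.1.+1), b.2).
have fI : injective f.
  move=> [b s] [c t] [bc ->]; congr pair; move: bc.
  by case: ifP; case: ifP; lia.
apply: (rst_trans _ _ _ (Gauss (relabel_wf (stack D E) fI))).
  by apply/rst_step/Or31; exists f; split=> // b c _ _; apply: fI.
apply: wslF_eq_strandwise_perm => k; rewrite !ffunE /= map_cat perm_catC -!map_comp.
have -> : map (relabel f \o relabel lft) (D k) = map (relabel rgt) (D k).
  by apply: eq_map => -[[b s] h]; rewrite /relabel /f /= odd_double.
have -> // : map (relabel f \o relabel rgt) (E k) = map (relabel lft) (E k).
by apply: eq_map => -[[b s] h]; rewrite /relabel /f /= odd_double.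
Qed.

Definition gen i j s : wSLF n := wSLF_class (single i j s).

Lemma gen_diag i s : gen i i s = wSLF_one n.
Proof.
apply/wSLF_classP/rst_step/Or32/Or41; exists (0%N, s); split.
  apply/orP; left; apply/existsP; exists i.
  by rewrite ffunE eqxx; apply: infix_refl.
by apply/ffunP => k; rewrite !ffunE; case: ifP => _; rewrite /= ?inE ?eqxx.
Qed.

Lemma gen_inv i j s : i != j -> wSLF_mul (gen i j s) (gen i j (~~ s)) = wSLF_one n.
Proof.
move=> ij; rewrite wSLF_classM; apply/wSLF_classP/rst_step/Or32/Or42.
exists (0%N, s), (1%N, ~~ s); split=> /=.
- by rewrite negbK.
- apply/orP; left; apply/existsP; exists i.
  by rewrite !ffunE eqxx (negbTE ij); apply: infix_refl.
- apply/orP; left; apply/existsP; exists j.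
  by rewrite !ffunE eqxx eq_sym (negbTE ij); apply: infix_refl.
apply/ffunP => k; rewrite !ffunE.
by case: (k == i); case: (k == j); rewrite /= ?inE ?xpair_eqE ?eqxx ?orbT.
Qed.

(** Negative powers are powers of the one-arrow diagram with a negative arrow. *)
Definition gen_pow i j (z : int) : wSLF n :=
  match z with
  | Posz m => iter m (wSLF_mul (gen i j true)) (wSLF_one n)
  | Negz m => iter m.+1 (wSLF_mul (gen i j false)) (wSLF_one n)
  end.

(** Only a factor that meets its opposite needs [gen_inv]. *)
Lemma gen_powD1 i j (z : int) s : i != j ->
  gen_pow i j (sgn s + z) = wSLF_mul (gen i j s) (gen_pow i j z).
Proof.
move=> ij; have ginv t y : wSLF_mul (gen i j t) (wSLF_mul (gen i j (~~ t)) y) = y.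
  by rewrite wSLF_mulA gen_inv // wSLF_mul1.
have step (t : bool) z' : sgn t + z = z' ->
    gen_pow i j z' = wSLF_mul (gen i j t) (gen_pow i j z) ->
    gen_pow i j (sgn t + z) = wSLF_mul (gen i j t) (gen_pow i j z) by move=> ->.
case: s z step => -[[|m]|[|m]] step.
- exact: (step _ (Posz 1)).
- by apply: (step _ (Posz m.+2)) => //=; lia.
- by apply: (step _ (Posz 0)) => //; rewrite /= (ginv true).
- by apply: (step _ (Negz m)); [rewrite /=; lia | rewrite /= (ginv true)].
- exact: (step _ (Negz 0)).
- by apply: (step _ (Posz m)); [rewrite /=; lia | rewrite /= (ginv false)].
- exact: (step _ (Negz 1)).
by apply: (step _ (Negz m.+2)) => //=; lia.
Qed.

End Generators.

HB.instance Definition _ n :=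
  Monoid.isComLaw.Build (wSLF n) (wSLF_one n) (@wSLF_mul n)
    (@wSLF_mulA n) (@wSLF_mulC n) (@wSLF_mul1 n).

(** * The inverse of the linking numbers *)

Section Classification.
Variable n : nat.
Implicit Types (D : gauss n) (x y : wSLF n) (c : {ffun offdiag n -> int}).

Definition linking x : {ffun offdiag n -> int} := vlks (repr x).

Lemma linking_class D : linking (wSLF_class D) = vlks D.
Proof. by apply/vlks_wslF_eq/wSLF_classP/wSLF_classK. Qed.

Lemma vlks_empty : vlks (empty_gauss n) = 0.
Proof. by apply/ffunP => p; rewrite !ffunE vlkE !ffunE /word_vlk big_nil. Qed.

Lemma linking1 : linking (wSLF_one n) = 0.
Proof. by rewrite linking_class vlks_empty. Qed.

Lemma linkingM x y : linking (wSLF_mul x y) = linking x + linking y.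
Proof. by rewrite linking_class vlks_stack. Qed.

Definition realize c : wSLF n :=
  \big[@wSLF_mul n/wSLF_one n]_(p : offdiag n) gen_pow (val p).1 (val p).2 (c p).

(** For [i = j] both sides are [realize c]: no off-diagonal pair is [(i, i)], and
    [gen i i s] is trivial. *)
Lemma realizeD1 i j s c :
  realize (dirac i j s + c) = wSLF_mul (gen i j s) (realize c).
Proof.
have [ij|ij] := eqVneq i j.
  rewrite ij gen_diag wSLF_mul1; congr realize; apply/ffunP => p.
  have pN : (val p).1 != (val p).2 := valP p.
  rewrite !ffunE; case: eqP => [E|_]; last by rewrite add0r.
  by rewrite E eqxx in pN.
pose p : offdiag n := Sub (i, j) ij.
rewrite /realize (bigD1 p) // [in RHS](bigD1 p) //= !ffunE eqxx gen_powD1 //.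
rewrite -wSLF_mulA; congr (wSLF_mul _ (wSLF_mul _ _)).
apply: eq_bigr => q qp; rewrite !ffunE; case: eqP => [E|_]; last by rewrite add0r.
by case/eqP: qp; apply: val_inj.
Qed.

(** Induction on the number of endpoints: factoring out one arrow multiplies the
    class by a generator and, by [realizeD1], does the same to the right-hand
    side. *)
Lemma realize_linking : cancel linking realize.
Proof.
move=> x; rewrite -(wSLF_classK x) linking_class; move: (repr x) => {x} D.
have [m] := ubnP (size (endpoints D)); elim: m D => // m IH D; rewrite ltnS => Dm.
case E: (endpoints D) => [|e r].
  have -> : D = empty_gauss n.
    apply: gauss_inj; apply/ffunP => i; rewrite ffunE.
    case Di: (D i) => [|e s] //.
    have : e \in endpoints D by apply/endpointsP; exists i; rewrite Di mem_head.
    by rewrite E.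
  rewrite vlks_empty /realize big1 // => p _.
  by rewrite ffunE.
have eD : e \in endpoints D by rewrite E mem_head.
case/endpointsP: (eD) => k ek.
have [i [j [ti hj]]] : exists i j, arrow_tail e.1 \in D i /\ arrow_head e.1 \in D j.
  case: e ek {E eD} => a [] ak; have [l al] := opposite_endpoint ak.
    by exists l, k.
  by exists k, l.
have fD := wslF_eq_factor ti hj; set D' := Gauss (delete_wf [:: e.1] D) in fD.
rewrite (vlks_wslF_eq fD) vlks_stack vlks_single realizeD1 (IH D').
  by rewrite wSLF_classM; apply/esym/wSLF_classP.
apply: leq_trans Dm; rewrite endpoints_delete size_filter.
rewrite -(count_predC (fun e' : endpoint => e'.1 \notin [:: e.1])) -[X in (X < _)%N]addn0 ltn_add2l.
by rewrite -has_count; apply/hasP; exists e => //=; rewrite negbK inE.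
Qed.

Lemma linking_gen_pow i j (z : int) :
  linking (gen_pow i j z) = [ffun p => if val p == (i, j) then z else 0].
Proof.
have itr m s : linking (iter m (wSLF_mul (gen i j s)) (wSLF_one n))
    = [ffun p => if val p == (i, j) then sgn s *+ m else 0].
  elim: m => [|m IH] /=; first by rewrite linking1; apply/ffunP => p; rewrite !ffunE if_same.
  rewrite linkingM IH linking_class vlks_single; apply/ffunP => p; rewrite !ffunE.
  by case: ifP => _; rewrite ?mulrS ?addr0.
by case: z => m; rewrite itr; apply/ffunP => p; rewrite !ffunE;
  case: ifP => // _; rewrite /sgn; lia.
Qed.

Lemma linking_realize : cancel realize linking.
Proof.
move=> c; rewrite /realize (big_morph linking linkingM linking1).
apply/ffunP => q; rewrite sum_ffunE (bigD1 q) //= linking_gen_pow ffunE.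
rewrite -surjective_pairing eqxx big1 ?addr0 // => p pq.
rewrite linking_gen_pow ffunE -surjective_pairing; case: eqP => // E.
by case/eqP: pq; apply: val_inj.
Qed.

End Classification.

Theorem proposition3p6 (n : nat) (n_gt0 : (0 < n)%N) :
  [/\ (forall D D' : gauss n, gauss_iso D D' -> vlks D = vlks D'),
      (forall D D' : gauss n, welded_move D D' -> vlks D = vlks D'),
      (forall D D' : gauss n, F_move D D' -> vlks D = vlks D')
    & exists phi : wSLF n -> {ffun offdiag n -> int},
        [/\ forall D : gauss n, phi (wSLF_class D) = vlks D,
            phi 1%g = 0,
            forall x y : wSLF n, phi (x * y)%g = phi x + phi y
          & bijective phi]].
Proof.
split; [exact: vlks_iso | exact: vlks_welded | exact: vlks_F |].
exists (@linking n); split.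
- exact: linking_class.
- exact: linking1.
- exact: linkingM.
by exists (@realize n); [exact: realize_linking | exact: linking_realize].
Qed.
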